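(* Let $L\subset\mathbb{R}P^n$ be a projective subspace with $\dim L=n-2$ and let $A\subset\mathbb{R}P^n$ be an $L$-convex-concave set. Suppose that there exist four sections $A_i=A\cap N_i$, $i=1,\dots,4$, of $A$ by hyperplanes $N_i\supset L$ such that $A$ is linear between these sections. Then $A$ contains a projective line.
   Context: For a projective subspace $T\subset\mathbb{R}P^n$, $\mathbb{R}P^n/T$ is the projective space of dimension $n-\dim T-1$ whose points are the $(\dim T+1)$-dimensional subspaces containing $T$; the projection from the center $T$ sends $x\notin T$ to the span of $x$ and $T$. The empty subspace has dimension $-1$. A nonempty subset of a projective space is convex if it is disjoint from some hyperplane $H$ and is convex in the affine space obtained by removing $H$. A closed set $A\subset\mathbb{R}P^n$ is $L$-convex-concave if: 1) $A\cap L=\emptyset$; 2) for every $(\dim L+1)$-dimensional subspace $N\supset L$ the section $A\cap N$ is convex; 3) for every $(\dim L-1)$-dimensional subspace $T\subset L$ the complement in $\mathbb{R}P^n/T$ of the projection of $A$ from the center $T$ is an open convex set. Linearity between sections: hyperplanes containing the codimension-2 subspace $L$ are parameterized by the points of the projective line $\mathbb{R}P^n/L$, hence are cyclically ordered. Let $N_1,\dots,N_4$ be distinct hyperplanes containing $L$, numbered in cyclic order (indices mod 4). The set $A$ is linear between the cyclically ordered sections $A_i=A\cap N_i$ if for each $i$ the intersection of $A$ with the half-space of projective space bounded by the adjacent hyperplanes $N_i$ and $N_{i+1}$ (the closed one containing no other $N_j$) coincides with the convex hull of $A_i\cup A_{i+1}$, the convex hull being taken in any affine chart $\mathbb{R}P^n\setminus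 N_j$ with $j\ne i,i+1$ (the result does not depend on the choice of such a chart). *)

(* Defs.v *)
(* MathComp / MathComp-Analysis *)
From HB Require Import structures.
From mathcomp Require Import all_boot all_order all_algebra.
From mathcomp Require Import all_classical all_reals all_analysis.

Set Implicit Arguments.
Unset Strict Implicit.
Unset Printing Implicit Defensive.

Import Order.TTheory GRing.Theory Num.Theory.
Import numFieldNormedType.Exports.

Local Open Scope classical_set_scope.
Local Open Scope ring_scope.

(* RP^n is the projectivization of 'rV[R]_n.+1, and a projective subspace of
   dimension d is a linear subspace of dimension d + 1; the empty subspace is
   0%VS. All the \dim below are linear dimensions. *)

(* The points of RP^n / T: the subspaces containing T whose dimension is one
   more than that of T. *)
Definition rpquot (R : realType) (n : nat) (T : {vspace 'rV[R]_n.+1}) :=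
  {U : {vspace 'rV[R]_n.+1} | (T <= U)%VS && (\dim U == (\dim T).+1)}.

HB.instance Definition _ (R : realType) (n : nat) (T : {vspace 'rV[R]_n.+1}) :=
  Choice.on (rpquot T).

(* RP^n itself is the quotient by the empty subspace: its points are lines
   through the origin. *)
Definition RP (R : realType) (n : nat) := rpquot (0%VS : {vspace 'rV[R]_n.+1}).

(* The preimage of B under 'rV_n.+1 \ T -> RP^n / T, v |-> T + <[v]>. *)
Definition vectors_of (R : realType) (n : nat) (T : {vspace 'rV[R]_n.+1})
    (B : set (rpquot T)) : set 'rV[R]_n.+1 :=
  [set v | v \notin T /\ exists2 U, B U & v \in val U].

Section QuotientTopology.
Context {R : realType} {n : nat} (T : {vspace 'rV[R]_n.+1}).

Let rpquot_open : set_system (rpquot T) := [set B | open (vectors_of B)].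

Lemma dim_addv_line (v : 'rV[R]_n.+1) :
  v \notin T -> \dim (T + <[v]>) = (\dim T).+1.
Proof.
move=> vT; rewrite dimv_disjoint_sum.
  have v0 : v != 0 by apply/eqP => v0; rewrite v0 mem0v in vT.
  by rewrite dim_vline v0 addn1.
apply/eqP; rewrite -subv0; apply/subvP => w.
rewrite memv_cap => /andP[wT /vlineP[k kE]]; move: wT; rewrite kE.
have [->|k0] := eqVneq k 0; first by rewrite scale0r !mem0v.
by move=> /(memvZ k^-1); rewrite scalerA mulVf // scale1r (negPf vT).
Qed.

Lemma rpquot_uniq (U V : rpquot T) (v : 'rV[R]_n.+1) :
  v \notin T -> v \in val U -> v \in val V -> U = V.
Proof.
move=> vT; suff span (W : rpquot T) : v \in val W -> val W = (T + <[v]>)%VS.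
  by move=> vU vV; apply: val_inj; rewrite (span U vU) (span V vV).
case: W => W /= /andP[TW /eqP dW] vW; apply/esym/eqP; rewrite eqEdim.
by rewrite subv_add TW -memvE vW /= dW dim_addv_line.
Qed.

Lemma vspace_closed (U : {vspace 'rV[R]_n.+1}) :
  closed [set v : 'rV[R]_n.+1 | v \in U].
Proof.
pose p : 'rV[R]_n.+1 -> 'rV[R]_n.+1 := fun v => v - projv U v.
pose q := fun (i : 'I_n.+1) (v : 'rV[R]_n.+1) => p v ord0 i.
have qE i v : q i v = \sum_j v ord0 j * q i (delta_mx ord0 j).
  rewrite /q /p {1 2}(row_sum_delta v) linear_sum /= -sumrB summxE.
  by apply: eq_bigr => j _; rewrite linearZ /= -scalerBr mxE.
have qc i : continuous (q i).
  rewrite (_ : q i = fun v => \sum_j v ord0 j * q i (delta_mx ord0 j));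
    last by apply/funext => v; exact: qE.
  apply: continuous_big => [|j _ v]; first exact: add_continuous.
  have cj := @coord_continuous R 1 n.+1 ord0 j v.
  exact: (cvgM cj (cvg_cst (q i (delta_mx ord0 j)))).
rewrite (_ : [set v | _] = \bigcap_(i in setT) (q i @^-1` [set 0])).
  apply: closed_bigI => i _; apply: preimage_closed.
    by move=> v _; exact: qc.
  exact: closed_eq.
apply/seteqP; split => v /=.
  by move=> vU i _; rewrite /q /p /= projv_id // subrr mxE.
move=> qv; suff : p v = 0.
  by move/eqP; rewrite subr_eq0 => /eqP ->; exact: memv_proj.
by apply/rowP => i; rewrite [RHS]mxE; exact: (qv i I).
Qed.

Let rpquot_openT : rpquot_open setT.
Proof.
rewrite /rpquot_open /= (_ : vectors_of _ = ~` [set v | v \in T]).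
  by apply: closed_openC; exact: vspace_closed.
apply/seteqP; split => v /=; first by case=> /negP.
move=> /negP vT; split => //.
have pr : (T <= T + <[v]>)%VS && (\dim (T + <[v]>) == (\dim T).+1).
  by rewrite addvSl dim_addv_line ?eqxx.
exists (Sub (T + <[v]>)%VS pr : rpquot T) => //=.
exact: (subvP (addvSr T <[v]>)) (memv_line v).
Qed.

Let rpquot_openI : setI_closed rpquot_open.
Proof.
move=> A B oA oB; rewrite /rpquot_open /=.
rewrite (_ : vectors_of _ = vectors_of A `&` vectors_of B); first exact: openI.
apply/seteqP; split => v /=.
  by case=> vT [U [AU BU] vU]; split; split => //; exists U.
case=> -[vT [U AU vU]] [_ [V BV vV]]; split=> //.
by exists U => //; split=> //; rewrite (rpquot_uniq vT vU vV).
Qed.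

Let rpquot_open_bigU (I : Type) (f : I -> set (rpquot T)) :
  (forall i, rpquot_open (f i)) -> rpquot_open (\bigcup_i f i).
Proof.
move=> of_; rewrite /rpquot_open /=.
rewrite (_ : vectors_of _ = \bigcup_i vectors_of (f i)).
  by apply: bigcup_open => i _; exact: of_.
apply/seteqP; split => v /=.
  by case=> vT [U [i _ fU] vU]; exists i => //; split => //; exists U.
by case=> i _ [vT [U fU vU]]; split=> //; exists U => //; exists i.
Qed.

(* The quotient topology: B is open iff its set of representatives is open in
   'rV_n.+1 \ T, equivalently in 'rV_n.+1. *)
HB.instance Definition _ := isOpenTopological.Build (rpquot T)
  rpquot_openT rpquot_openI rpquot_open_bigU.

Lemma rpquot_openE (B : set (rpquot T)) : open B <-> open (vectors_of B).
Proof. by []. Qed.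

End QuotientTopology.

Definition points_in (R : realType) (n : nat) (T W : {vspace 'rV[R]_n.+1}) :
    set (rpquot T) :=
  [set U | (val U <= W)%VS].
Arguments points_in {R n} T W.

(* The image of the projection of A from the center T; the dimension
   constraint on y : rpquot T discards the points of A lying in T, where the
   projection is undefined. *)
Definition projection_from (R : realType) (n : nat) (T : {vspace 'rV[R]_n.+1})
    (A : set (RP R n)) : set (rpquot T) :=
  [set y | exists2 x, A x & val y = (val x + T)%VS].
Arguments projection_from {R n} T A.

(* Convexity of B in the affine space (RP^n / T) \ H: a linear form f with
   kernel H identifies a point U outside H with the coset U :&: f @^-1` [1] of
   T, and the form is unique up to a nonzero factor, which does not affect
   convexity. *)
Definition affine_convex (R : realType) (n : nat) (T : {vspace 'rV[R]_n.+1})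
    (H : {vspace 'rV[R]_n.+1}) (B : set (rpquot T)) : Prop :=
  B `&` points_in T H = set0 /\
  forall f : 'Hom('rV[R]_n.+1, R^o), lker f = H ->
    convex_set (vectors_of B `&` [set v | f v = 1]).

Definition projective_convex (R : realType) (n : nat)
    (T : {vspace 'rV[R]_n.+1}) (B : set (rpquot T)) : Prop :=
  B !=set0 /\
  exists H : {vspace 'rV[R]_n.+1},
    [/\ (T <= H)%VS, \dim H = n & affine_convex H B].

Definition convex_concave (R : realType) (n : nat) (L : {vspace 'rV[R]_n.+1})
    (A : set (RP R n)) : Prop :=
  [/\ closed A,
      A `&` points_in 0%VS L = set0,
      forall N : {vspace 'rV[R]_n.+1}, (L <= N)%VS -> \dim N = (\dim L).+1 ->
        projective_convex (A `&` points_in 0%VS N) &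
      forall T : {vspace 'rV[R]_n.+1}, (T <= L)%VS -> (\dim T).+1 = \dim L ->
        open (~` projection_from T A) /\
        projective_convex (~` projection_from T A)].

(* For L of codimension 2, f and g are homogeneous coordinates on the
   projective line RP^n / L, and the hyperplane with equation
   sin t * f = cos t * g makes one full turn around L as t ranges over
   [0, pi[. Both orientations are allowed (exchange f and g), and the
   hyperplanes are necessarily distinct. *)
Definition cyclically_ordered (R : realType) (n : nat)
    (L : {vspace 'rV[R]_n.+1}) (N : 'I_4 -> {vspace 'rV[R]_n.+1}) : Prop :=
  exists (f g : 'Hom('rV[R]_n.+1, R^o)) (t : 'I_4 -> R),
    [/\ (lker f :&: lker g)%VS = L,
        forall i, N i = lker (sin (t i) *: f - cos (t i) *: g),
        forall i j : 'I_4, (i < j)%N -> t i < t j &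
        t ord_max < t ord0 + pi].

(* The two closed half-spaces bounded by the hyperplanes lker f and lker g are
   half_space f g and half_space f (- g). *)
Definition half_space (R : realType) (n : nat)
    (f g : 'Hom('rV[R]_n.+1, R^o)) : set (RP R n) :=
  [set x : RP R n | forall v, v \in val x -> 0 <= (f v : R) * (g v : R)].

Definition convex_hull (R : realType) (n : nat) (H : {vspace 'rV[R]_n.+1})
    (S : set (RP R n)) : set (RP R n) :=
  [set x : RP R n | forall C : set (RP R n), affine_convex H C -> S `<=` C -> C x].

(* ordS i is i + 1 modulo 4. *)
Definition linear_between (R : realType) (n : nat)
    (N : 'I_4 -> {vspace 'rV[R]_n.+1}) (A : set (RP R n)) : Prop :=
  forall (i : 'I_4) (f g : 'Hom('rV[R]_n.+1, R^o)),
    lker f = N i -> lker g = N (ordS i) ->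
    (forall j, j != i -> j != ordS i ->
       ~ (points_in 0%VS (N j) `<=` half_space f g)) ->
    forall j, j != i -> j != ordS i ->
      A `&` half_space f g =
      convex_hull (N j) ((A `&` points_in 0%VS (N i)) `|`
                         (A `&` points_in 0%VS (N (ordS i)))).

(* Main.v *)
(* Over the hyperplane of RP^n through L with homogeneous coordinates e in the
   plane V / L, the set A is a compact convex subset K(e) of a translate of L,
   with K(k e) = k K(e). Separating a point of K(e + e') from K(e) + K(e') by a
   linear form on L and projecting from the kernel of that form shows that the
   third axiom forces K(e + e') to lie in K(e) + K(e').
   Let e_0, ..., e_3 be the four given directions. Each x in K(e_0) is then a
   combination of some y in K(e_1) and w in K(e_3), and each y in K(e_1) one of
   some x' in K(e_0) and z in K(e_2). The relation x ~> x' has a fixed point,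
   and there x, y, z, w span only a plane. By linearity between the sections
   every vector of this plane is in the cone over A. *)
Require Import Defs.
From HB Require Import structures.
From mathcomp Require Import all_boot all_order all_algebra.
From mathcomp Require Import all_classical all_reals all_analysis.
From mathcomp Require Import ring lra.

Set Implicit Arguments.
Unset Strict Implicit.
Unset Printing Implicit Defensive.

Import Order.TTheory GRing.Theory Num.Theory.
Import numFieldNormedType.Exports.

Local Open Scope classical_set_scope.
Local Open Scope ring_scope.

(** * The Euclidean inner product and continuity of linear forms *)

Definition dotv (R : realType) (n : nat) (u v : 'rV[R]_n) : R^o :=
  (v *m u^T) ord0 ord0.

Section Dot.
Context {R : realType} {n : nat}.
Implicit Types u v w : 'rV[R]_n.

Fact dotv_is_linear u : linear (dotv u).
Proof. by move=> a v w; rewrite /dotv mulmxDl -scalemxAl !mxE. Qed.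

HB.instance Definition _ u :=
  GRing.isLinear.Build R 'rV[R]_n R^o _ (dotv u) (dotv_is_linear u).

Lemma dotvE u v : dotv u v = \sum_i u ord0 i * v ord0 i.
Proof. by rewrite /dotv mxE; apply: eq_bigr => i _; rewrite mxE mulrC. Qed.

Lemma dotvC u v : dotv u v = dotv v u.
Proof. by rewrite !dotvE; apply: eq_bigr => i _; rewrite mulrC. Qed.

Lemma dotvDr u v w : dotv u (v + w) = (dotv u v : R) + dotv u w.
Proof. exact: linearD. Qed.

Lemma dotvBr u v w : dotv u (v - w) = (dotv u v : R) - dotv u w.
Proof. exact: linearB. Qed.

Lemma dotvZr (a : R) u v : dotv u (a *: v) = a * (dotv u v : R).
Proof. exact: linearZ. Qed.

Lemma dotvv_ge0 u : 0 <= dotv u u :> R.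
Proof. by rewrite dotvE; apply: sumr_ge0 => i _; rewrite -expr2 sqr_ge0. Qed.

Lemma dotvv_gt0 u : u != 0 -> 0 < dotv u u :> R.
Proof.
move=> u0; rewrite lt_def dotvv_ge0 andbT; apply: contra u0.
rewrite dotvE psumr_eq0 => [/allP u0|i _]; last by rewrite -expr2 sqr_ge0.
apply/eqP/rowP => i; apply/eqP.
by have := u0 i (mem_index_enum i); rewrite mulf_eq0 orbb mxE.
Qed.

Lemma continuous_form (f : 'Hom('rV[R]_n, R^o)) :
  continuous (f : 'rV[R]_n -> R).
Proof.
rewrite (_ : (f : _ -> _) = fun v => \sum_j v ord0 j * f (delta_mx ord0 j)).
  apply: continuous_big => [|j _ v]; first exact: add_continuous.
  have cj := @coord_continuous R 1 n ord0 j v.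
  exact: (cvgM cj (cvg_cst (f (delta_mx ord0 j) : R))).
apply/funext => v; rewrite {1}(row_sum_delta v) linear_sum.
by apply: eq_bigr => j _; rewrite linearZ.
Qed.

Lemma continuous_dotv u : continuous (dotv u : 'rV[R]_n -> R).
Proof.
rewrite (_ : (dotv u : _ -> _) = linfun (dotv u)); first exact: continuous_form.
by apply/funext => v; rewrite lfunE.
Qed.

Lemma continuous_dotvv : continuous (fun v => dotv v v : R).
Proof.
rewrite (_ : (fun v => _) = fun v => \sum_j v ord0 j * v ord0 j); last first.
  by apply/funext => v; rewrite dotvE.
apply: continuous_big => [|j _ v]; first exact: add_continuous.
have cj := @coord_continuous R 1 n ord0 j v.
exact: (cvgM cj cj).
Qed.

End Dot.

(** * Nearest points and fixed points for compact convex sets *)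

Section ConvexSets.
Context {R : realType}.

Lemma convex_setP (V : lmodType R) (C : set V) :
  convex_set C <->
  forall u v (a b : R), C u -> C v -> 0 <= a -> 0 <= b -> a + b = 1 ->
    C (a *: u + b *: v).
Proof.
split=> [cC u v a b Cu Cv a0 b0 ab|cC u v k /set_mem Cu /set_mem Cv];
    last first.
  apply/mem_set; apply: cC => //; last by rewrite subrKC.
  by rewrite subr_ge0.
have a01 : 0 <= a <= 1 by rewrite a0 -ab lerDl b0.
have := cC u v (Itv01 (andP a01).1 (andP a01).2) (mem_set Cu) (mem_set Cv).
move=> /set_mem; congr C.
rewrite /conv/= (_ : unstable.onem a = b) // /unstable.onem -ab.
by rewrite addrAC subrr add0r.
Qed.

Context {n : nat}.
Implicit Types C : set 'rV[R]_n.

(** [d] is the point of [C] nearest the origin: if [dotv d (c - d)] were negative, a short move from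
    [d] towards [c] would decrease the norm. *)
Lemma min_norm_point C : compact C -> C !=set0 -> convex_set C ->
  exists2 d, C d & forall c, C c -> dotv d d <= dotv d c :> R.
Proof.
move=> kC C0 /convex_setP cC.
have [|d /set_mem Cd dmin] := compact_EVT_min C0 kC
  (f := fun v : 'rV[R]_n => dotv v v : R).
  by apply: continuous_subspaceT; exact: continuous_dotvv.
exists d => // c Cc; rewrite leNgt; apply/negP => lt.
have [e eE] : exists e, e = c - d by exists (c - d).
have q t : 0 <= t <= 1 -> 0 <= 2 * t * dotv d e + t ^+ 2 * dotv e e :> R.
  move=> /andP[t0 t1].
  have /mem_set/dmin := cC c d t (1 - t) Cc Cd t0 (etrans (subr_ge0 _ _) t1)
    (subrKC _ _).
  rewrite (_ : t *: c + _ = d + t *: e); last first.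
    by rewrite eE scalerBr scalerBl scale1r addrCA.
  rewrite dotvDr dotvZr (dotvC _ d) (dotvC _ e) !dotvDr !dotvZr (dotvC e d).
  by lra.
have de : dotv d e < 0 :> R by rewrite eE dotvBr subr_lt0.
(* The step [t = x / (x + z)] is at most 1, unlike the optimal [x / z], and it makes the change of
   squared norm, [- 2 t x + t^2 z], equal to [- t x - t^2 x < 0]. *)
pose x := - dotv d e : R; pose z := dotv e e : R.
have x0 : 0 < x by rewrite oppr_gt0.
have xz : 0 < x + z by rewrite ltr_wpDr// dotvv_ge0.
pose t := x / (x + z).
have t0 : 0 < t by rewrite divr_gt0.
have tz : t * z = x - t * x by rewrite /t; field; rewrite gt_eqF.
have := q t; rewrite ltW//= ler_pdivrMr// mul1r lerDl dotvv_ge0 => /(_ isT).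
have -> : dotv d e = - x :> R by rewrite opprK.
rewrite -/z expr2 -(mulrA t t z) tz; apply/negP; rewrite -ltNge.
move: x t x0 t0 {xz tz} => x t x0 t0.
have := mulr_gt0 t0 x0; have := mulr_gt0 (mulr_gt0 t0 t0) x0.
by lra.
Qed.

(* Fixed point of the relation x ~> x' given by x = a y + b w, x' = c y + d z.
   Its graph is convex, so if no x' - x is 0 some e has <e, x' - x> > 0
   throughout, which fails at an x maximising <e, .>. *)
Lemma convex_relation_fixpoint (K0 K1 K2 K3 : set 'rV[R]_n) (a b c d : R) :
  compact K0 -> compact K1 -> compact K2 -> compact K3 ->
  convex_set K0 -> convex_set K1 -> convex_set K2 -> convex_set K3 ->
  K0 !=set0 ->
  (forall x, K0 x -> exists y w, [/\ K1 y, K3 w & x = a *: y + b *: w]) ->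
  (forall y, K1 y -> exists x z, [/\ K0 x, K2 z & x = c *: y + d *: z]) ->
  exists y w z, [/\ K1 y, K3 w, K2 z, K0 (a *: y + b *: w) &
    a *: y + b *: w = c *: y + d *: z].
Proof.
move=> k0 k1 k2 k3 /convex_setP c0 /convex_setP c1 /convex_setP c2.
move=> /convex_setP c3 nK0 K013 K102.
(* A triple [p = (y, w, z)] encodes an arrow of the relation, from [F p] to [G p]; the set [C] below
   collects the displacements. *)
pose F (p : 'rV[R]_n * 'rV[R]_n * 'rV[R]_n) : 'rV[R]_n :=
  a *: p.1.1 + b *: p.1.2.
pose G (p : 'rV[R]_n * 'rV[R]_n * 'rV[R]_n) : 'rV[R]_n :=
  c *: p.1.1 + d *: p.2.
have cF : continuous F.
  move=> p; apply: cvgD; apply: cvgZr.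
    by apply: (cvg_comp _ _ (@cvg_fst _ _ _ _ _)); exact: cvg_fst.
  by apply: (cvg_comp _ _ (@cvg_fst _ _ _ _ _)); exact: cvg_snd.
have cG : continuous G.
  move=> p; apply: cvgD; apply: cvgZr.
    by apply: (cvg_comp _ _ (@cvg_fst _ _ _ _ _)); exact: cvg_fst.
  exact: cvg_snd.
pose S := (K1 `*` K3 `*` K2) `&` (F @^-1` K0 `&` G @^-1` K0).
have K0cl : closed K0 by apply: compact_closed k0; exact: norm_hausdorff.
have kS : compact S.
  apply: compact_closedI; first exact: compact_setX (compact_setX _ _) _.
  by apply: closedI; apply: preimage_closed => //.
pose C := (fun p => G p - F p) @` S.
have kC : compact C.
  apply: continuous_compact kS; apply: continuous_subspaceT => p.
  by apply: cvgB; [exact: cG|exact: cF].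
have cC : convex_set C.
  apply/convex_setP => u v r s [[[y w] z] [[[/= y1 w3] z2] [x0 x0']] uE].
  move=> [[[y' w'] z'] [[[/= y1' w3'] z2'] [u0 u0']] vE] r0 s0 rs; subst u v.
  have FE : F (r *: y + s *: y', r *: w + s *: w', r *: z + s *: z') =
      r *: F (y, w, z) + s *: F (y', w', z').
    by rewrite /F/= !scalerDr !scalerA addrACA !(mulrC a, mulrC b).
  have GE : G (r *: y + s *: y', r *: w + s *: w', r *: z + s *: z') =
      r *: G (y, w, z) + s *: G (y', w', z').
    by rewrite /G/= !scalerDr !scalerA addrACA !(mulrC c, mulrC d).
  exists (r *: y + s *: y', r *: w + s *: w', r *: z + s *: z').
    split; first by split; [split|]; [exact: c1|exact: c3|exact: c2].
    by split; rewrite /preimage/= ?FE ?GE; exact: c0.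
  by rewrite FE GE !scalerBr opprD addrACA.
have SP x : K0 x -> exists p, S p /\ F p = x.
  move=> K0x; have [y [w [K1y K3w xE]]] := K013 _ K0x.
  have [x' [z [K0x' K2z x'E]]] := K102 _ K1y.
  exists (y, w, z); split; last by rewrite /F.
  by split; [|split; rewrite /preimage/= /F /G/= -?xE -?x'E].
have C0 : C !=set0.
  have [x K0x] := nK0; have [p [Sp _]] := SP _ K0x.
  by exists (G p - F p); exists p.
have [e [[[y w] z] [[/= [K1y K3w] K2z] [K0x K0x']] eE] emin] :=
  min_norm_point kC C0 cC.
have [e0|/eqP/dotvv_gt0 e0] := pselect (e = 0).
  exists y, w, z; split=> //.
  by apply/esym/eqP; rewrite -subr_eq0; apply/eqP; move: eE; rewrite e0.
(* An arrow leaving a maximiser [x] of [dotv e] ends in [K0], so it cannot gain the [dotv e e > 0]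
   that minimality of [e] demands. *)
have [|x /set_mem K0X xmax] := compact_EVT_max nK0 k0 (f := dotv e).
  by apply: continuous_subspaceT; exact: continuous_dotv.
have [p [Sp Fp]] := SP _ K0X.
have /emin : C (G p - x) by exists p; rewrite ?Fp.
rewrite dotvBr; have [_ [_ /mem_set/xmax]] := Sp.
by move: e0; set u := dotv e e; set v := dotv e x; set q := dotv e (G p); lra.
Qed.

End ConvexSets.

(** * Representatives of points, cones over convex sets, and equations of hyperplanes *)

Section Points.
Context {R : realType} {n : nat}.
Local Notation V := 'rV[R]_n.+1.
Implicit Types (T H : {vspace V}) (u v w : V) (f : 'Hom(V, R^o)).

Lemma rpquot_span T v : v \notin T ->
  exists U : rpquot T, val U = (T + <[v]>)%VS.
Proof.
move=> vT; have UP : (T <= T + <[v]>)%VS && (\dim (T + <[v]>) == (\dim T).+1).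
  by rewrite addvSl dim_addv_line ?eqxx.
by exists (Sub (T + <[v]>)%VS UP).
Qed.

Lemma rpquotE T (U : rpquot T) v :
  v \notin T -> v \in val U -> val U = (T + <[v]>)%VS.
Proof.
move=> vT vU; have [W WE] := rpquot_span vT; rewrite -WE; congr val.
apply: rpquot_uniq vT vU _.
by rewrite WE -[X in X \in _]add0r memv_add ?mem0v ?memv_line.
Qed.

Lemma vectors_ofP T (B : set (rpquot T)) (U : rpquot T) v :
  v \notin T -> v \in val U -> vectors_of B v <-> B U.
Proof.
move=> vT vU; split=> [[_ [W BW vW]]|BU]; last by split=> //; exists U.
by rewrite (rpquot_uniq vT vU vW).
Qed.

Lemma vectors_ofC T (B : set (rpquot T)) v :
  v \notin T -> vectors_of (~` B) v <-> ~ vectors_of B v.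
Proof.
move=> vT; have [U UE] := rpquot_span vT.
have vU : v \in val U.
  by rewrite UE -[X in X \in _]add0r memv_add ?mem0v ?memv_line.
by rewrite !(vectors_ofP _ vT vU).
Qed.

Lemma vectors_ofZ T (B : set (rpquot T)) (k : R) v :
  k != 0 -> vectors_of B v -> vectors_of B (k *: v).
Proof.
move=> k0 [vT [U BU vU]]; split; last by exists U => //; exact: memvZ.
by apply: contra vT => /(memvZ k^-1); rewrite scalerA mulVf// scale1r.
Qed.

Lemma vectors_of_projection T (A : set (RP R n)) v : v \notin T ->
  vectors_of (projection_from T A) v <->
  exists2 a, vectors_of A a & a - v \in T.
Proof.
move=> vT; split=> [[_ [U [x Ax UE]]]|[a [a0 [x Ax ax]] avT]].
  rewrite UE => /memv_addP[a ax [t tT vE]].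
  exists a; last by rewrite vE opprD addNKr rpredN.
  split; last by exists x.
  by rewrite memv0; apply: contra vT => /eqP a0; rewrite vE a0 add0r.
have [U UE] := rpquot_span vT; split=> //; exists U; last first.
  by rewrite UE -[X in X \in _]add0r memv_add ?mem0v ?memv_line.
exists x => //; rewrite UE (rpquotE a0 ax) add0v addvC.
have [aE vE] : a = v + (a - v) /\ v = a - (a - v) by rewrite subrKC subKr.
apply/eqP; rewrite eqEsubv !subv_add !addvSr/= -!memvE.
by rewrite {1}vE memv_add ?memv_line ?rpredN//= {1}aE memv_add ?memv_line.
Qed.

(** Put [s = f (a v + b w)]. Divided by [s], the combination is a convex one of the representatives
    with [f = 1], with weights [a f(v) / s] and [b f(w) / s]. These are nonnegative because [f v],
    [f w] and [s] have the same sign. *)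
Lemma affine_convex_cone T (C : set (rpquot T)) f v w (a b : R) :
  affine_convex (lker f) C -> vectors_of C v -> vectors_of C w ->
  0 < (f v : R) * f w -> 0 <= a -> 0 <= b -> 0 < a + b ->
  vectors_of C (a *: v + b *: w).
Proof.
move=> [_ /(_ f erefl)/convex_setP cC] Cv Cw fvw a0 b0 ab.
have fv0 : f v != 0 :> R by apply: contraTneq fvw => ->; rewrite mul0r ltxx.
have fw0 : f w != 0 :> R by apply: contraTneq fvw => ->; rewrite mulr0 ltxx.
pose s : R := a * f v + b * f w.
have sfv : 0 < s * f v.
  rewrite /s mulrDl -!mulrA [f w * f v]mulrC -expr2.
  have fv2 : 0 < (f v : R) ^+ 2 by rewrite exprn_even_gt0.
  have [a_gt0|a_le0] := ltP 0 a.
    by apply: ltr_wpDr; [rewrite mulr_ge0// ltW|rewrite mulr_gt0].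
  by apply: ltr_wpDl; [rewrite mulr_ge0// ltW|rewrite mulr_gt0//; lra].
have s0 : s != 0 by apply: contraTneq sfv => ->; rewrite mul0r ltxx.
have sfw : 0 < s * f w.
  rewrite -(pmulr_rgt0 _ sfv) mulrACA pmulr_rgt0//.
  by rewrite -expr2 exprn_even_gt0.
have unit_ u : f u != 0 :> R -> vectors_of C u ->
    (vectors_of C `&` [set v | f v = 1]) ((f u)^-1 *: u).
  move=> fu0 Cu; split; first by apply: vectors_ofZ => //; rewrite invr_eq0.
  by rewrite /= linearZ/= /GRing.scale/= mulVf.
have ge0 (r t : R) : 0 <= r -> 0 < s * t -> 0 <= r * t / s.
  move=> r0 st; rewrite -mulrA mulr_ge0//.
  rewrite (_ : t / s = s * t / s ^+ 2) ?divr_ge0 ?sqr_ge0 ?ltW//.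
  by field.
have ss : a * f v / s + b * f w / s = 1 by rewrite -mulrDl mulfV.
have [/(vectors_ofZ s0) + _] := cC _ _ (a * f v / s) (b * f w / s)
  (unit_ v fv0 Cv) (unit_ w fw0 Cw) (ge0 _ _ a0 sfv) (ge0 _ _ b0 sfw) ss.
congr vectors_of.
by rewrite scalerDr !scalerA !(mulrC s) !divfK// !mulfK.
Qed.

Lemma limg_form f v : v \notin lker f -> limg f = fullv.
Proof.
rewrite memv_ker => fv; apply/eqP; rewrite eqEdim subvf/= dimvf/=.
rewrite [X in (X <= _)%N](_ : _ = 1%N)// lt0n dimv_eq0.
apply: contra fv => /eqP f0; rewrite -memv0 -f0 memv_img ?memvf//.
Qed.

Lemma dim_lker_form f v : v \notin lker f -> \dim (lker f) = n.
Proof.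
move=> /limg_form f1; have := limg_ker_dim f fullv.
by rewrite capfv f1 !dimvf /dim/= mul1n addn1 => -[].
Qed.

(** Every coordinate of [v - projv H v] is a form vanishing on [H], and some coordinate is nonzero
    at a vector outside [H]; its kernel is then [H] by dimension. *)
Lemma hyperplane_form H : \dim H = n -> exists f, lker f = H.
Proof.
move=> dH; have /subvPn[u _ uH] : ~~ (fullv <= H)%VS.
  by apply/negP => /dimvS; rewrite dH dimvf/= /dim/= mul1n ltnn.
have [i ui] : exists i, (u - projv H u) ord0 i != 0.
  apply/existsP; apply: contraNT uH; rewrite negb_exists => /forallP u0.
  have -> : u = projv H u.
    apply/eqP; rewrite -subr_eq0; apply/eqP/rowP => i.
    by move/negPn: (u0 i) => /eqP ->; rewrite mxE.
  exact: memv_proj.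
pose f := (linfun (dotv (delta_mx ord0 i : V)) \o (\1 - projv H))%VF.
have fE v : f v = (v - projv H v) ord0 i.
  rewrite comp_lfunE lfunE/= add_lfunE opp_lfunE id_lfunE dotvE (bigD1 i)//=.
  rewrite big1 => [|j ji]; first by rewrite addr0 mxE !eqxx mul1r.
  by rewrite mxE (negPf ji) andbF mul0r.
exists f; apply/esym/eqP; rewrite eqEdim; apply/andP; split.
  by apply/subvP => v vH; rewrite memv_ker fE projv_id// subrr mxE.
by rewrite dH (@dim_lker_form _ u)// memv_ker fE.
Qed.

End Points.

Section PointsIn.
Context {R : realType} {n : nat} (T : {vspace 'rV[R]_n.+1}).
Implicit Types (W H : {vspace 'rV[R]_n.+1}) (B : set (rpquot T)).

Lemma vectors_of_points_in W B v : (T <= W)%VS ->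
  vectors_of (B `&` points_in T W) v <-> vectors_of B v /\ v \in W.
Proof.
move=> TW; split=> [[vT [U [BU /subvP UW] vU]]|[[vT [U BU vU]] vW]].
  by split; [split=> //; exists U|exact: UW].
split=> //; exists U => //; split=> //.
by rewrite /points_in/= (rpquotE vT vU) subv_add TW -memvE.
Qed.

Lemma affine_convex_notin H B v : (T <= H)%VS -> affine_convex H B ->
  vectors_of B v -> v \notin H.
Proof.
move=> TH [BH _] Bv; apply/negP => vH.
have [_ [U]] : vectors_of (B `&` points_in T H) v by exact/vectors_of_points_in.
by rewrite BH.
Qed.

End PointsIn.

(* The section of A over the point (a : b) of RP^n / L, in the chart where it is
   a subset of an affine space directed by L = lker f :&: lker g. *)
Definition slice (R : realType) (n : nat) (A : set (RP R n))
    (f g : 'Hom('rV[R]_n.+1, R^o)) (a b : R) : set 'rV[R]_n.+1 :=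
  vectors_of A `&` [set v | f v = a /\ g v = b].

(** * Compactness, convexity and concavity of the sections through the center *)

Section Slices.
Context {R : realType} {n : nat} (L : {vspace 'rV[R]_n.+1}) (A : set (RP R n)).
Context (f g : 'Hom('rV[R]_n.+1, R^o)).
Hypotheses (dimL : (\dim L).+1 = n) (ccA : convex_concave L A).
Hypothesis LE : (lker f :&: lker g)%VS = L.
Local Notation V := 'rV[R]_n.+1.
Local Notation X := (vectors_of A).

Lemma mem_center (v : V) : (v \in L) = (f v == 0) && (g v == 0).
Proof. by rewrite -LE memv_cap !memv_ker. Qed.

Lemma memB_center (u v : V) : (u - v \in L) = (f u == f v) && (g u == g v).
Proof. by rewrite mem_center !raddfB/= !subr_eq0. Qed.

Lemma vectors_of_notin_center (v : V) : X v -> v \notin L.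
Proof.
move=> Xv; apply/negP => vL; have [_ AL _ _] := ccA.
have [_ [U]] : vectors_of (A `&` points_in 0%VS L) v.
  by apply/vectors_of_points_in; rewrite ?sub0v.
by rewrite AL.
Qed.

Lemma mem_lker_comb (a b : R) (v : V) :
  (v \in lker (b *: f - a *: g)) = (b * f v == a * g v :> R).
Proof. by rewrite memv_ker !lfunE/= !lfunE/= !lfunE/= subr_eq0. Qed.

Lemma center_sub_comb (a b : R) : (L <= lker (b *: f - a *: g))%VS.
Proof.
apply/subvP => v; rewrite mem_center mem_lker_comb => /andP[/eqP-> /eqP->].
by rewrite !mulr0.
Qed.

Lemma dim_lker_comb (a b : R) : \dim (lker (b *: f - a *: g)) = n ->
  (a != 0) || (b != 0).
Proof.
apply: contra_eqT; rewrite negb_or !negbK => /andP[/eqP-> /eqP->].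
rewrite !scale0r subrr (_ : lker _ = fullv) ?dimvf /dim/= ?mul1n ?gtn_eqF//.
apply/eqP; rewrite eqEsubv subvf/=; apply/subvP => v _.
by rewrite memv_ker lfunE.
Qed.

(** The second axiom gives a point of [A] in the hyperplane. A representative is off [L], so its
    values under [f] and [g] are a nonzero multiple of [(a, b)], and it can be rescaled. *)
Lemma slice_nonempty (a b : R) : \dim (lker (b *: f - a *: g)) = n ->
  slice A f g a b !=set0.
Proof.
move=> dN; have [_ _ /(_ _ (center_sub_comb a b))] := ccA.
rewrite dN dimL => /(_ erefl)[[U [AU UN] _] _].
have v0 : vpick (val U) != 0.
  rewrite vpick0; apply: contraTneq (valP U) => ->.
  by rewrite dimv0 andbF.
have vU := memv_pick (val U); set v := vpick (val U) in v0 vU.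
have Xv : X v by split; [rewrite memv0|exists U].
have vL := vectors_of_notin_center Xv.
have := subvP UN _ vU; rewrite mem_lker_comb => /eqP bfag.
have fE (k : R) : f v = k * a :> R -> g v = k * b :> R ->
    slice A f g a b !=set0.
  move=> fv gv; have k0 : k != 0.
    by apply: contraNneq vL => k0; rewrite mem_center fv gv k0 !mul0r eqxx.
  exists (k^-1 *: v); split; first by apply: vectors_ofZ; rewrite ?invr_eq0.
  by rewrite /= !linearZ/= fv gv /GRing.scale/= !mulKf.
have [a0|b0] := orP (dim_lker_comb dN).
  apply: (fE (f v / a)); rewrite ?divfK// mulrAC (mulrC _ b) bfag.
  by rewrite mulrAC mulfV// mul1r.
apply: (fE (g v / b)); rewrite ?divfK// mulrAC (mulrC _ a) -bfag.
by rewrite mulrAC mulfV// mul1r.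
Qed.

(* If the affine chart puts v and w on opposite sides of L, it contains the
   segment from v to - w, which meets L. *)
Lemma slice_convex (a b : R) : \dim (lker (b *: f - a *: g)) = n ->
  convex_set (slice A f g a b).
Proof.
move=> dN; apply/convex_setP.
move=> v w s t [Xv [/= fv gv]] [Xw [/= fw gw]] s0 t0 st.
split; last first.
  by rewrite /= !linearD !linearZ/= fv gv fw gw -!scalerDl st !scale1r.
have [_ _ /(_ _ (center_sub_comb a b))] := ccA.
rewrite dN dimL => /(_ erefl)[_ [H [_ dH]]] + _.
have [h <- cB] := hyperplane_form dH.
have Bv : vectors_of (A `&` points_in 0%VS (lker (b *: f - a *: g))) v.
  apply/vectors_of_points_in; rewrite ?sub0v//; split=> //.
  by rewrite mem_lker_comb fv gv mulrC.
have Bw : vectors_of (A `&` points_in 0%VS (lker (b *: f - a *: g))) w.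
  apply/vectors_of_points_in; rewrite ?sub0v//; split=> //.
  by rewrite mem_lker_comb fw gw mulrC.
have BX u : vectors_of (A `&` points_in 0%VS (lker (b *: f - a *: g))) u -> X u.
  by move=> /(vectors_of_points_in _ _ (sub0v _))[].
have hv := affine_convex_notin (sub0v _) cB Bv.
have hw := affine_convex_notin (sub0v _) cB Bw.
have [hvw|hvw|/eqP] := ltgtP 0 ((h v : R) * h w).
- by apply: BX; apply: (affine_convex_cone cB) => //; rewrite st.
- have /BX/vectors_of_notin_center : vectors_of
      (A `&` points_in 0%VS (lker (b *: f - a *: g))) (1 *: v + 1 *: (-1 *: w)).
    apply: (affine_convex_cone cB) => //.
      by apply: vectors_ofZ; rewrite ?oppr_eq0 ?oner_eq0.
    by rewrite linearZ/= /GRing.scale/= mulN1r mulrN oppr_gt0.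
  by rewrite !scale1r scaleN1r memB_center fv gv fw gw !eqxx.
by rewrite eq_sym mulf_eq0 -!memv_ker (negPf hv) (negPf hw).
Qed.

(** The form [phi = f^2 + g^2] vanishes only on [L], which [A] avoids, so it has a positive minimum
    on the unit vectors of the closed cone over [A]. By homogeneity it bounds the norm on the
    slice. *)
Lemma slice_compact (a b : R) :
  (a != 0) || (b != 0) -> compact (slice A f g a b).
Proof.
move=> ab0; have [clA _ _ _] := ccA.
(* [Z] is the cone over [A] with the origin added, which makes it closed. *)
pose Z := ~` vectors_of (~` A).
have clZ : closed Z.
  exact: open_closedC (closed_openC clA : open (vectors_of (~` A))).
have XZ v : v != 0 -> X v <-> Z v.
  move=> v0; have v0' : v \notin (0%VS : {vspace V}) by rewrite memv0.
  split=> [Xv /(vectors_ofC _ v0')//|nX].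
  by apply: contrapT => /(vectors_ofC _ v0').
have eqK (h : 'Hom(V, R^o)) (c : R) : closed [set v | h v = c].
  rewrite (_ : [set v | _] = h @^-1` [set c])//.
  apply: preimage_closed => [v _|]; last exact: closed_eq.
  exact: continuous_form.
have clK : closed (slice A f g a b).
  rewrite (_ : slice _ _ _ _ _ =
    Z `&` ([set v | f v = a] `&` [set v | g v = b])).
    by apply: closedI => //; apply: closedI; exact: eqK.
  apply/seteqP; split=> v [Xv [/= fv gv]]; split=> //; apply/XZ => //.
    by case: Xv; rewrite memv0.
  by apply: contraTneq ab0 => v0; rewrite -fv -gv v0 !linear0 eqxx.
apply: bounded_closed_compact clK.
have norm_cont : continuous (fun v : V => `|v|) by exact: norm_continuous.
pose S := Z `&` [set v : V | `|v| = 1].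
have clS : closed S.
  apply: closedI => //.
  rewrite (_ : [set v : V | _] = (fun v : V => `|v|) @^-1` [set 1])//.
  by apply: preimage_closed => [v _|]; [exact: norm_cont|exact: closed_eq].
have kS : compact S.
  apply: bounded_closed_compact clS; exists 1; split=> // x x1 v [_ /= ->].
  exact: ltW.
pose phi (v : V) : R := f v ^+ 2 + g v ^+ 2.
have phic : continuous phi.
  move=> v; have cf := @continuous_form _ _ f v.
  have cg := @continuous_form _ _ g v.
  rewrite (_ : phi = fun v => (f v : R) * f v + (g v : R) * g v).
    exact: cvgD (cvgM cf cf) (cvgM cg cg).
  by apply/funext => w; rewrite /phi !expr2.
have phiZ (k : R) v : phi (k *: v) = k ^+ 2 * phi v.
  by rewrite /phi !linearZ/= /GRing.scale/= !exprMn mulrDr.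
have normS v : slice A f g a b v -> v != 0 /\ S (`|v|^-1 *: v).
  move=> [Xv _]; have v0 : v != 0 by case: Xv; rewrite memv0.
  have nv0 : `|v| != 0 by rewrite normr_eq0.
  split=> //; split; last by rewrite /= normrZ normfV normr_id mulVf.
  apply/XZ; rewrite ?scaler_eq0 ?invr_eq0 ?negb_or ?nv0//.
  by apply: vectors_ofZ; rewrite ?invr_eq0.
have [S0|S0] := pselect (S !=set0); last first.
  exists 0; split=> // x x0 v /normS[_ Sv].
  by case: S0; exists (`|v|^-1 *: v).
have [|u /set_mem[Zu u1] umin] := compact_EVT_min S0 kS (f := phi).
  exact: continuous_subspaceT.
have m0 : 0 < phi u.
  have u0 : u != 0 by rewrite -normr_eq0 u1 oner_eq0.
  have /vectors_of_notin_center : X u by apply/XZ.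
  rewrite mem_center negb_and lt_def addr_ge0 ?sqr_ge0// andbT.
  apply: contraTneq => /eqP.
  by rewrite paddr_eq0 ?sqr_ge0// !sqrf_eq0 negb_or !negbK.
(* Homogeneity gives [|v|^2 <= (a^2 + b^2) / phi u]; the bound [|v| <= 1 + |v|^2] avoids a square
   root. *)
exists (1 + (a ^+ 2 + b ^+ 2) / phi u).
split=> [|x xlt v /[dup] Kv /normS[v0 Sv]]; first exact: num_real.
apply: le_trans (ltW xlt).
have := umin _ (mem_set Sv).
rewrite phiZ exprVn ler_pdivlMl ?exprn_gt0 ?normr_gt0//.
have -> : phi v = a ^+ 2 + b ^+ 2 by rewrite /phi; case: Kv => _ [/= -> ->].
rewrite -ler_pdivlMr// => h; apply: le_trans (lerD (lexx 1) h).
have := sqr_ge0 (`|v| - 1); have := normr_ge0 v.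
by set r := `|v|; nra.
Qed.

(** Supplies centers for the third axiom: [dotv d] is nonzero on [L], as its value at [d] shows, so
    rank-nullity applies. *)
Lemma dim_orthogonal (d : V) : d \in L -> d != 0 ->
  (\dim (L :&: lker (linfun (dotv d)))).+1 = \dim L.
Proof.
move=> dL d0; have := limg_ker_dim (linfun (dotv d)) L; move=> <-.
rewrite -[LHS]addn1; congr (_ + _)%N; apply/esym/eqP; rewrite eqn_leq.
apply/andP; split.
  by have := dimvS (subvf (linfun (dotv d) @: L)%VS); rewrite dimvf.
rewrite lt0n dimv_eq0; apply: contraTneq (dotvv_gt0 d0) => D0.
have := memv_img (linfun (dotv d)) dL.
by rewrite D0 memv0 lfunE/= => /eqP ->; rewrite ltxx.
Qed.

(* Otherwise project from T = L :&: d^perp. The complement of the image contains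
   both w_k + d / 2, while a form F whose kernel avoids that complement is a
   nonzero multiple of <d, .> on L and vanishes at a point of A over each w_k,
   so it has the same sign at w_1 + d / 2 and at w_2 + d / 2; by convexity their
   sum is outside the image too. *)
Lemma not_sum_of_extremal_points (d w1 w2 : V) : d \in L -> d != 0 ->
  X w1 -> (forall u, X u -> u - w1 \in L -> dotv d u <= dotv d w1 :> R) ->
  X w2 -> (forall u, X u -> u - w2 \in L -> dotv d u <= dotv d w2 :> R) ->
  ~ X (w1 + w2 + d).
Proof.
move=> dL d0 Xw1 w1max Xw2 w2max Xp.
have [_ _ _] := ccA; set T := (L :&: lker (linfun (dotv d)))%VS.
have TL : (T <= L)%VS by exact: capvSl.
have memT u : (u \in T) = (u \in L) && (dotv d u == 0 :> R).
  by rewrite memv_cap memv_ker lfunE.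
have notinT u : u \notin L -> u \notin T by apply: contra; exact: subvP.
move=> /(_ _ TL (dim_orthogonal dL d0))[_ [_ [H [TH dH]]]].
have [F FH] := hyperplane_form dH; move: TH; rewrite -{H dH}FH => TH cC.
pose C := ~` projection_from T A; rewrite -/C in cC.
have CP v : v \notin T -> vectors_of C v <-> ~ exists2 a, X a & a - v \in T.
  move=> vT; split=> [/(vectors_ofC _ vT) + Pv|nP].
    by apply; exact/vectors_of_projection.
  by apply/(vectors_ofC _ vT) => /(vectors_of_projection _ vT).
have dd := dotvv_gt0 d0.
(* A vector of the cone over [A] congruent to [d] modulo [T] would lie in [L]. *)
have Cd : vectors_of C d.
  apply/CP; first by rewrite memT negb_and gt_eqF ?orbT.
  case=> a /(vectors_of_notin_center) aL /(subvP TL) adL.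
  by move: aL; rewrite -(subrK d a) memvD.
have Fd0 : F d != 0 by rewrite -memv_ker; exact: affine_convex_notin TH cC Cd.
have Fd2 : 0 < (F d : R) * F d by rewrite -expr2 exprn_even_gt0.
(* Both [F] and [dotv d] vanish on [T], a hyperplane of [L], so they are proportional on [L]. *)
have FL u : u \in L -> F u = dotv d u / dotv d d * F d :> R.
  move=> uL; have /(subvP TH) : u - (dotv d u / dotv d d : R) *: d \in T.
    by rewrite memT memvB ?memvZ//= dotvBr dotvZr divfK ?subrr// gt_eqF.
  by rewrite memv_ker linearB linearZ/= subr_eq0 => /eqP.
have half w : X w ->
    (forall u, X u -> u - w \in L -> dotv d u <= dotv d w :> R) ->
    vectors_of C (w + 2^-1 *: d) /\ 0 < (F (w + 2^-1 *: d) : R) * F d.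
  move=> Xw wmax; have wL := vectors_of_notin_center Xw.
  have notL (k : R) : w + k *: d \notin L by rewrite rpredDr// memvZ.
  split.
    apply/CP; first exact: notinT.
    case=> a Xa; rewrite memT dotvBr dotvDr dotvZr subr_eq0.
    move=> /andP[awL /eqP da].
    have /(wmax _ Xa) : a - w \in L.
      by rewrite -(subrK (2^-1 *: d) (a - w)) memvD ?memvZ// -addrA -opprD.
    by rewrite da gerDl leNgt mulr_gt0// invr_gt0.
  (* This translate of [w] along [d] is a zero of [F]. The complement of the projection avoids the
     kernel of [F], so [v] is congruent modulo [T] to some [a] in the cone over [A], and
     [F a = 0]. *)
  pose v := w - (F w / F d : R) *: d.
  have vL : v \notin L by rewrite /v -scaleNr.
  have nCv : ~ vectors_of C v.
    move=> /(affine_convex_notin TH cC); rewrite memv_ker linearB linearZ/=.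
    by rewrite /GRing.scale/= divfK// subrr eqxx.
  have [a Xa avT] : exists2 a, X a & a - v \in T.
    by apply: contrapT => nP; apply/nCv/CP => //; exact: notinT.
  have Fa0 : F a = 0.
    have := subvP TH _ avT; rewrite memv_ker linearB/= linearB linearZ/=.
    by rewrite /GRing.scale/= divfK// subrr subr0 => /eqP.
  have awL : a - w \in L.
    rewrite (_ : a - w = a - v - (F w / F d : R) *: d).
      by rewrite memvB ?memvZ// (subvP TL).
    by rewrite /v opprB addrA addrAC addrK.
  have xL : w + 2^-1 *: d - a \in L.
    by rewrite addrAC memvD ?memvZ// -opprB rpredN.
  (* Now [F (w + d/2) = F (w + d/2 - a)] has the sign of [F d], since [dotv d (w - a) >= 0] by
     maximality and [d/2] contributes a positive term. *)
  rewrite -[X in F X](subrK a) linearD/= Fa0 addr0 (FL _ xL).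
  rewrite -(mulrA _ (F d : R) (F d)) mulr_gt0// divr_gt0// dotvBr dotvDr dotvZr.
  rewrite addrAC ltr_wpDl ?subr_ge0 ?wmax//.
  by rewrite mulr_gt0// invr_gt0.
have [Cq1 Fq1] := half _ Xw1 w1max; have [Cq2 Fq2] := half _ Xw2 w2max.
have Fq : 0 < (F (w1 + 2^-1 *: d) : R) * F (w2 + 2^-1 *: d).
  by have := mulr_gt0 Fq1 Fq2; rewrite mulrACA pmulr_lgt0.
have := affine_convex_cone cC Cq1 Cq2 Fq ler01 ler01 (addr_gt0 ltr01 ltr01).
have -> : 1 *: (w1 + 2^-1 *: d) + 1 *: (w2 + 2^-1 *: d) = w1 + w2 + d.
  rewrite !scale1r addrACA -scalerDl (_ : 2^-1 + 2^-1 = 1 :> R) ?scale1r//.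
  by field.
have pT : w1 + w2 + d \notin T by apply/notinT/(vectors_of_notin_center).
by move/(CP _ pT); apply; exists (w1 + w2 + d); rewrite ?subrr ?mem0v.
Qed.

(* The vector d of least norm among the p - (s v + t w) lies in L, and by
   minimality s v and t w maximise <d, .> on their fibres. *)
Lemma slice_concave (a b a' b' s t : R) (p : V) :
  \dim (lker (b *: f - a *: g)) = n -> \dim (lker (b' *: f - a' *: g)) = n ->
  s != 0 -> t != 0 -> slice A f g (s * a + t * a') (s * b + t * b') p ->
  exists v w, [/\ slice A f g a b v, slice A f g a' b' w & p = s *: v + t *: w].
Proof.
move=> dN dN' s0 t0 [Xp [/= fp gp]].
have k1 := slice_compact (dim_lker_comb dN).
have k2 := slice_compact (dim_lker_comb dN').
have /convex_setP c1 := slice_convex dN.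
have /convex_setP c2 := slice_convex dN'.
have [v0 Kv0] := slice_nonempty dN.
have [w0 Kw0] := slice_nonempty dN'.
pose S := slice A f g a b `*` slice A f g a' b'.
pose D (q : V * V) : V := p - (s *: q.1 + t *: q.2).
have kC : compact (D @` S).
  apply: continuous_compact (compact_setX k1 k2).
  apply: continuous_subspaceT => q; apply: cvgB; first exact: cvg_cst.
  by apply: cvgD; apply: cvgZr; [exact: cvg_fst|exact: cvg_snd].
have cC : convex_set (D @` S).
  apply/convex_setP => u u' x y [[v w] [/= Kv Kw] uE].
  move=> [[v' w'] [/= Kv' Kw'] uE'].
  move=> x0 y0 xy; subst u u'.
  exists (x *: v + y *: v', x *: w + y *: w').
    by split; [exact: c1|exact: c2].
  rewrite /D/= !scalerBr addrACA -scalerDl xy scale1r -opprD; congr (_ - _).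
  by rewrite !scalerDr !scalerA addrACA !(mulrC s, mulrC t).
have [|d [[v w] [/= Kv Kw] dE] dmin] := min_norm_point kC _ cC.
  by exists (D (v0, w0)); exists (v0, w0).
have [[Xv [/= fv gv]] [Xw [/= fw gw]]] := (Kv, Kw).
have pE : p = s *: v + t *: w + d by rewrite -dE /D/= subrKC.
have [d0|/eqP d0] := pselect (d = 0); first by exists v, w; rewrite pE d0 addr0.
have dL : d \in L.
  rewrite mem_center -dE /D/= !linearB !linearD !linearZ/=.
  by rewrite fp gp fv gv fw gw /GRing.scale/= !mulrN -!opprD !subrr eqxx.
exfalso.
apply: (not_sum_of_extremal_points dL d0 (w1 := s *: v) (w2 := t *: w)).
- exact: vectors_ofZ.
- move=> u Xu; rewrite memB_center !linearZ/= fv gv.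
  move=> /andP[/eqP fu /eqP gu].
  have Ku : slice A f g a b (s^-1 *: u).
    split; first by apply: vectors_ofZ; rewrite ?invr_eq0.
    by rewrite /= !linearZ/= fu gu /GRing.scale/= !mulKf.
  (* Replacing [v] by [s^-1 u] turns the difference [d] into [d + (s v - u)], so minimality gives
     [dotv d (s v - u) >= 0]. *)
  have : (D @` S) (D (s^-1 *: u, w)) by exists (s^-1 *: u, w).
  move=> /dmin; rewrite /D/= scalerA mulfV// scale1r.
  rewrite (_ : p - _ = d + (s *: v - u)); last first.
    by apply/eqP; rewrite subr_eq pE !addrA subrK addrAC (addrC d).
  by rewrite dotvDr dotvBr dotvZr lerDl subr_ge0.
- exact: vectors_ofZ.
- move=> u Xu; rewrite memB_center !linearZ/= fw gw.
  move=> /andP[/eqP fu /eqP gu].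
  have Ku : slice A f g a' b' (t^-1 *: u).
    split; first by apply: vectors_ofZ; rewrite ?invr_eq0.
    by rewrite /= !linearZ/= fu gu /GRing.scale/= !mulKf.
  have : (D @` S) (D (v, t^-1 *: u)) by exists (v, t^-1 *: u).
  move=> /dmin; rewrite /D/= scalerA mulfV// scale1r.
  rewrite (_ : p - _ = d + (t *: w - u)); last first.
    apply/eqP; rewrite subr_eq pE (addrC _ u) !addrA subrK.
    by apply/eqP; rewrite [LHS]addrC (addrC (s *: v)) addrA.
  by rewrite dotvDr dotvBr dotvZr lerDl subr_ge0.
- by rewrite -pE.
Qed.

End Slices.

(** * Segments of [A] between adjacent sections *)

Section LinearBetween.
Context {R : realType} {n : nat}.
Local Notation V := 'rV[R]_n.+1.
Implicit Types (F G h : 'Hom(V, R^o)) (v w : V).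

(** Every convex set competing in the definition of the hull contains the combination, by
    [affine_convex_cone]. *)
Lemma convex_hull_cone (S : set (RP R n)) h v w (a b : R) :
  vectors_of S v -> vectors_of S w -> 0 < (h v : R) * h w ->
  0 <= a -> 0 <= b -> 0 < a + b ->
  vectors_of (convex_hull (lker h) S) (a *: v + b *: w).
Proof.
move=> Sv Sw hvw a0 b0 ab.
have SC (C : set (RP R n)) u : S `<=` C -> vectors_of S u -> vectors_of C u.
  by move=> SC [u0 [U /SC CU uU]]; split=> //; exists U.
have hull C : affine_convex (lker h) C -> S `<=` C ->
    vectors_of C (a *: v + b *: w).
  by move=> cC SsC; apply: (affine_convex_cone cC) => //; exact: (SC C).
(* There may be no competing convex set, so nonvanishing is proved directly: [h v] times the value
   of [h] at the combination is positive. *)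
have u0 : a *: v + b *: w \notin (0%VS : {vspace V}).
  rewrite memv0; apply: contraTneq hvw => u0.
  have : a * (h v * h v : R) + b * (h v * h w : R) = 0.
    rewrite !(mulrCA _ (h v : R)) -mulrDr.
    have := congr1 h u0; rewrite linearD !linearZ/= linear0 => ->.
    by rewrite mulr0.
  rewrite -leNgt => e; rewrite leNgt; apply/negP => hvw.
  have hv2 : 0 < (h v : R) * h v.
    rewrite -expr2 exprn_even_gt0//.
    by apply: contraTneq hvw => ->; rewrite mul0r ltxx.
  have [a_gt0|a_le0] := ltP 0 a.
    by have := mulr_gt0 a_gt0 hv2; have := mulr_ge0 b0 (ltW hvw); lra.
  have b_gt0 : 0 < b by lra.
  by have := mulr_gt0 b_gt0 hvw; have := mulr_ge0 a0 (ltW hv2); lra.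
have [U UE] := rpquot_span u0.
have uU : a *: v + b *: w \in val U by rewrite UE add0v memv_line.
split=> //; exists U => // C cC SsC.
by apply/(vectors_ofP C u0 uU); exact: hull.
Qed.

(** The signs of [F] and [G] select one of two half-spaces. A vector with [F u * G u < 0] in each
    remaining hyperplane certifies that it is the one to which linearity applies. *)
Lemma linear_between_segment (N : 'I_4 -> {vspace V}) (A : set (RP R n))
    (i j : 'I_4) F G h v w (a b : R) :
  linear_between N A -> lker F = N i -> lker G = N (ordS i) ->
  (forall k, k != i -> k != ordS i ->
    exists2 u, u \in N k & (F u : R) * G u < 0) ->
  j != i -> j != ordS i -> lker h = N j ->
  vectors_of A v -> v \in N i -> vectors_of A w -> w \in N (ordS i) ->
  0 < (h v : R) * h w -> 0 <= a -> 0 <= b -> 0 < a + b ->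
  vectors_of A (a *: v + b *: w).
Proof.
move=> lA Fi Gi sep ji jSi hj Av vN Aw wN hvw a0 b0 ab.
have AF : A `&` half_space F G = convex_hull (lker h)
    ((A `&` points_in 0%VS (N i)) `|` (A `&` points_in 0%VS (N (ordS i)))).
  rewrite hj; apply: lA => // k ki kSi half; have [u uk] := sep _ ki kSi.
  have u0 : u \notin (0%VS : {vspace V}) \/ u = 0.
    by have [->|u0] := eqVneq u 0; [right|left; rewrite memv0].
  case: u0 => [u0|->]; last by rewrite !linear0 mulr0 ltxx.
  have [U UE] := rpquot_span u0.
  have uU : u \in val U by rewrite UE add0v memv_line.
  have /half/(_ u uU) : points_in 0%VS (N k) U.
    by rewrite /points_in/= UE add0v -memvE.
  by rewrite leNgt => /negP.
have US (S1 S2 : set (RP R n)) u :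
    vectors_of S1 u \/ vectors_of S2 u -> vectors_of (S1 `|` S2) u.
  by case=> -[u0 [U SU uU]]; split=> //; exists U => //; [left|right].
have : vectors_of (A `&` half_space F G) (a *: v + b *: w).
  rewrite AF; apply: convex_hull_cone => //; apply: US.
    by left; apply/vectors_of_points_in; rewrite ?sub0v.
  by right; apply/vectors_of_points_in; rewrite ?sub0v.
by move=> [u0 [U [AU _] uU]]; split=> //; exists U.
Qed.

End LinearBetween.

(** * From a fixed point of the relation between sections to a line in [A] *)

Theorem proposition2 (R : realType) (n : nat) (L : {vspace 'rV[R]_n.+1})
    (A : set (RP R n)) (N : 'I_4 -> {vspace 'rV[R]_n.+1}) :
  (\dim L).+1 = n ->
  convex_concave L A ->
  (forall i, (L <= N i)%VS /\ \dim (N i) = n) ->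
  cyclically_ordered L N ->
  linear_between N A ->
  exists l : {vspace 'rV[R]_n.+1}, \dim l = 2%N /\ points_in 0%VS l `<=` A.
Proof.
move=> dimL ccA dimN [f [g [t [LE NE t_lt t_pi]]]] lA.
pose c i := cos (t i); pose s i := sin (t i).
(* With [e_i = (c i, s i)], [D i j] is the determinant of [e_i, e_j], that is [sin (t j - t i)]. It
   is positive for [i < j] because all the angles lie within less than [pi]. *)
pose D i j := c i * s j - s i * c j.
have Dpos (i j : 'I_4) : (i < j)%N -> 0 < D i j.
  move=> ij; rewrite (_ : D i j = sin (t j - t i)); last first.
    by rewrite sinB /D mulrC [s i * _]mulrC.
  have le_t (k l : 'I_4) : (k <= l)%N -> t k <= t l.
    by rewrite leq_eqVlt => /orP[/eqP/val_inj->//|/t_lt/ltW].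
  have := le_t ord0 i (leq0n _); have := le_t j ord_max (leq_ord _).
  by move=> ? ?; apply: sin_gt0_pi; have := t_lt _ _ ij; lra.
have DN i j : D i j = - D j i by rewrite /D; ring.
have Dneg (i j : 'I_4) : (j < i)%N -> D i j < 0.
  by move=> /Dpos Dji; rewrite DN oppr_lt0.
pose phi i := s i *: f - c i *: g.
have dphi i : \dim (lker (phi i)) = n by rewrite -NE; exact: (dimN i).2.
have phiE i v : phi i v = s i * (f v : R) - c i * (g v : R) :> R.
  by rewrite !lfunE/= !lfunE/= !lfunE.
pose K i := slice A f g (c i) (s i).
have K0 i := slice_nonempty dimL ccA LE (dphi i).
have Kcvx i := slice_convex dimL ccA LE (dphi i).
have Kcpt i := slice_compact ccA LE (dim_lker_comb (dphi i)).
pose i0 : 'I_4 := ord0; pose i1 : 'I_4 := Ordinal (isT : (1 < 4)%N).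
pose i2 : 'I_4 := Ordinal (isT : (2 < 4)%N).
pose i3 : 'I_4 := Ordinal (isT : (3 < 4)%N).
have D01 : 0 < D i0 i1 by exact: Dpos.
have D02 : 0 < D i0 i2 by exact: Dpos.
have D03 : 0 < D i0 i3 by exact: Dpos.
have D12 : 0 < D i1 i2 by exact: Dpos.
have D13 : 0 < D i1 i3 by exact: Dpos.
(* The coefficients come from Cramer's rule: [e_0 = a e_1 + b e_3 = c e_1 + d e_2]. *)
have [||y [w [z [Ky Kw Kz]]]] := convex_relation_fixpoint
  (a := D i0 i3 / D i1 i3) (b := - (D i0 i1 / D i1 i3))
  (c := D i0 i2 / D i1 i2) (d := - (D i0 i1 / D i1 i2))
  (Kcpt i0) (Kcpt i1) (Kcpt i2) (Kcpt i3)
  (Kcvx i0) (Kcvx i1) (Kcvx i2) (Kcvx i3) (K0 i0).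
- move=> x Kx; have := @slice_concave _ _ L A f g dimL ccA LE _ _ _ _
    (D i0 i3 / D i1 i3) (- (D i0 i1 / D i1 i3)) x (dphi i1) (dphi i3).
  case=> [||| y [w [Ky Kw xE]]]; last by exists y, w.
  + by rewrite mulf_neq0 ?invr_eq0 ?gt_eqF.
  + by rewrite oppr_eq0 mulf_neq0 ?invr_eq0 ?gt_eqF.
  + move: Kx; congr (slice A f g _ _ x).
      by rewrite /D; field; rewrite -/(D i1 i3) gt_eqF.
    by rewrite /D; field; rewrite -/(D i1 i3) gt_eqF.
- move=> y Ky; have := @slice_concave _ _ L A f g dimL ccA LE _ _ _ _
    (D i1 i2 / D i0 i2) (D i0 i1 / D i0 i2) y (dphi i0) (dphi i2).
  case=> [||| x [z [Kx Kz yE]]].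
  + by rewrite mulf_neq0 ?invr_eq0 ?gt_eqF.
  + by rewrite mulf_neq0 ?invr_eq0 ?gt_eqF.
  + move: Ky; congr (slice A f g _ _ y).
      by rewrite /D; field; rewrite -/(D i0 i2) gt_eqF.
    by rewrite /D; field; rewrite -/(D i0 i2) gt_eqF.
  (* Concavity was applied to [e_1] as a combination of [e_0] and [e_2]; here the resulting equation
     is solved for [x]. *)
  exists x, z; split=> //; rewrite yE scalerDr !scalerA -addrA -scalerDl.
  rewrite [X in X *: x](_ : _ = 1); last by field; rewrite !gt_eqF.
  rewrite [X in X *: z](_ : _ = 0); last by field; rewrite !gt_eqF.
  by rewrite scale1r scale0r addr0.
set x := _ + _ => Kx xE.
(* [p i] is the image of [e_i] under the linear map sending [e_0] to [x] and [e_1] to [y]; the two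
   expressions for [x] make it send [e_2] to [z] and [e_3] to [w]. *)
pose p i := (D i0 i / D i0 i1) *: y + (D i i1 / D i0 i1) *: x.
have p0 : p i0 = x.
  rewrite /p mulfV ?gt_eqF// scale1r (_ : D i0 i0 = 0) ?mul0r ?scale0r ?add0r//.
  by rewrite /D; ring.
have p1 : p i1 = y.
  rewrite /p mulfV ?gt_eqF// scale1r (_ : D i1 i1 = 0) ?mul0r ?scale0r ?addr0//.
  by rewrite /D; ring.
have p2 : p i2 = z.
  rewrite /p xE scalerDr !scalerA addrA -scalerDl.
  rewrite [X in X *: y](_ : _ = 0); last first.
    by rewrite (DN i2 i1); field; rewrite !gt_eqF.
  rewrite [X in X *: z](_ : _ = 1); last first.
    by rewrite (DN i2 i1); field; rewrite !gt_eqF.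
  by rewrite scale0r add0r scale1r.
have p3 : p i3 = w.
  rewrite /p /x scalerDr !scalerA addrA -scalerDl.
  rewrite [X in X *: y](_ : _ = 0); last first.
    by rewrite (DN i3 i1); field; rewrite !gt_eqF.
  rewrite [X in X *: w](_ : _ = 1); last first.
    by rewrite (DN i3 i1); field; rewrite !gt_eqF.
  by rewrite scale0r add0r scale1r.
clearbody x.
have Kp i : K i (p i).
  case: i => -[|[|[|[|//]]]] ilt; [move: Kx|move: Ky|move: Kz|move: Kw].
  - by rewrite -p0; congr (K _ (p _)); exact: val_inj.
  - by rewrite -{1}p1; congr (K _ (p _)); exact: val_inj.
  - by rewrite -p2; congr (K _ (p _)); exact: val_inj.
  - by rewrite -p3; congr (K _ (p _)); exact: val_inj.
have Xp i : vectors_of A (p i) := (Kp i).1.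
have phip i j : phi i (p j) = - D i j :> R.
  by have [_ [fp gp]] := Kp j; rewrite phiE fp gp /D; ring.
have pN i : p i \in N i by rewrite NE memv_ker phip /D mulrC subrr oppr0.
have seg (i i' j : 'I_4) (a b : R) : val i' = i.+1 -> j != i -> j != i' ->
    0 <= a -> 0 <= b -> 0 < a + b -> vectors_of A (a *: p i + b *: p i').
  move=> i'E ji ji' a0 b0 ab; have Si : ordS i = i'.
    apply: val_inj; rewrite [LHS]/= -i'E modn_small//; exact: ltn_ord.
  have same_side k : k != i -> k != i' -> 0 < D i k * D i' k.
    move=> ki ki'; have [ik|ik|/val_inj ik] := ltngtP i k.
    - rewrite mulr_gt0 ?Dpos// ltn_neqAle i'E ik andbT -i'E.
      by apply: contra ki' => /eqP/val_inj->.
    - by rewrite nmulr_rgt0 Dneg// i'E ltnW.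
    - by rewrite ik eqxx in ki.
  (* Nonnegative combinations of [p i] and [p i'] satisfy [phi i <= 0 <= phi i'], hence the sign of
     the second form. At any other [p k] the product of the two forms is [- D i k * D i' k < 0]. *)
  subst i'; apply: (@linear_between_segment _ _ N A i j (phi i) (- phi (ordS i))
    (phi j)) (Xp i) (pN i) (Xp _) (pN _) _ a0 b0 ab => //.
  - by rewrite NE; apply/vspaceP => u; rewrite !memv_ker opp_lfunE oppr_eq0.
  - move=> k ki ki'; exists (p k) => //.
    by rewrite opp_lfunE !phip opprK mulNr oppr_lt0 same_side.
  - by rewrite !phip mulrNN (DN j i) (DN j (ordS i)) mulrNN same_side.
(* Past [N i3] the turning hyperplane comes back to [N i0] at angle [t i0 + pi], where the direction
   is [- e_0]; hence [- p i0], and no sign change in the second form. *)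
have last_seg (a b : R) : 0 <= a -> 0 <= b -> 0 < a + b ->
    vectors_of A (a *: p i3 + b *: - p i0).
  move=> a0 b0 ab; have Si : ordS i3 = i0 by exact: val_inj.
  have XNp : vectors_of A (- p i0).
    by rewrite -scaleN1r; apply: vectors_ofZ; rewrite ?oppr_eq0 ?oner_eq0.
  rewrite -Si in XNp *; apply: (@linear_between_segment _ _ N A i3 i1 (phi i3)
    (phi (ordS i3)) (phi i1)) (Xp i3) (pN i3) XNp _ _ a0 b0 ab => //.
  - move=> k k3; rewrite Si => k0; exists (p k) => //.
    rewrite !phip mulrNN nmulr_rlt0 ?Dpos ?Dneg//.
      by rewrite lt0n.
    rewrite ltn_neqAle -ltnS ltn_ord andbT.
    by apply: contra k3 => /eqP k3; apply/eqP/val_inj.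
  - by rewrite rpredN.
  - rewrite linearN/= !phip Si (DN i1 i0) !opprK mulNr oppr_gt0.
    by rewrite mulrN oppr_lt0 mulr_gt0.
pose l := (<[x]> + <[y]>)%VS.
have x0 : x != 0 by rewrite -p0; have [] := Xp i0; rewrite memv0.
have [_ [fx gx]] := Kx; have [_ [fy gy]] := Ky.
exists l; split.
  rewrite dim_addv_line ?dim_vline ?x0//; apply/negP => /vlineP[k yk].
  have : D i0 i1 = 0.
    by rewrite /D -fy -gy -fx -gx yk !linearZ/= /GRing.scale/=; ring.
  by apply/eqP; rewrite gt_eqF.
(* Cramer's rule in the plane [l], where [phi k (p m) = - D k m]. *)
have decomp i j v : v \in l ->
    D i j *: v = (phi j v : R) *: p i - (phi i v : R) *: p j.
  move=> /memv_addP[_ /vlineP[a ->] [_ /vlineP[b ->] ->]].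
  have phil k : phi k (a *: x + b *: y) = - (a * D k i0 + b * D k i1) :> R.
    by rewrite -{1}p0 -p1 linearD !linearZ/= !phip /GRing.scale/= !mulrN opprD.
  rewrite !phil /p -scaleNr !scalerDr !scalerA addrACA -!scalerDl addrC.
  congr (_ *: _ + _ *: _).
    by rewrite /D; field; rewrite -/(D i0 i1) gt_eqF.
  by rewrite /D; field; rewrite -/(D i0 i1) gt_eqF.
have sector (i j : 'I_4) v : (i < j)%N -> v \in l ->
    v = (phi j v / D i j : R) *: p i + (- phi i v / D i j : R) *: p j.
  move=> ij vl; have Dij := Dpos _ _ ij.
  rewrite -!(mulrC (D i j)^-1) -!scalerA -scalerDr scaleNr -decomp//.
  by rewrite scalerA mulVf ?scale1r// gt_eqF.
have sum_gt0 v (u u' : 'rV[R]_n.+1) (a b : R) :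
    v != 0 -> v = a *: u + b *: u' -> 0 <= a -> 0 <= b -> 0 < a + b.
  move=> v0 vE a0 b0; rewrite lt_def addr_ge0// andbT; apply: contra v0.
  by rewrite paddr_eq0// vE => /andP[/eqP-> /eqP->]; rewrite !scale0r addr0.
(* The vectors [p i0, p i1, p i2, p i3, - p i0] cut this half-plane into four sectors; the first
   nonnegative value among [phi i1 v, phi i2 v, phi i3 v] tells which one contains [v], the last
   sector being left if there is none. *)
have lX v : v \in l -> v != 0 -> phi i0 v <= 0 :> R -> vectors_of A v.
  move=> vl v0 h0.
  have adjacent (i i' j : 'I_4) : val i' = i.+1 -> j != i -> j != i' ->
      phi i v <= 0 :> R -> 0 <= phi i' v :> R -> vectors_of A v.
    move=> i'E ji ji' hi hi'; have ii' : (i < i')%N by rewrite i'E.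
    have vE := sector _ _ _ ii' vl.
    have a0 : 0 <= phi i' v / D i i' by rewrite divr_ge0// ltW// Dpos.
    have b0 : 0 <= - phi i v / D i i'.
      by rewrite divr_ge0 ?oppr_ge0// ltW// Dpos.
    by rewrite vE; apply: seg i'E ji ji' a0 b0 (sum_gt0 _ _ _ _ _ v0 vE a0 b0).
  have [h1|/ltW h1] := leP 0 (phi i1 v : R); first exact: (adjacent i0 i1 i2).
  have [h2|/ltW h2] := leP 0 (phi i2 v : R); first exact: (adjacent i1 i2 i0).
  have [h3|/ltW h3] := leP 0 (phi i3 v : R); first exact: (adjacent i2 i3 i0).
  have vE : v =
      (- phi i0 v / D i0 i3) *: p i3 + (- phi i3 v / D i0 i3) *: - p i0.
    by rewrite scalerN -scaleNr -mulNr opprK addrC; exact: sector.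
  have a0 : 0 <= - phi i0 v / D i0 i3 by rewrite divr_ge0 ?oppr_ge0// ltW.
  have b0 : 0 <= - phi i3 v / D i0 i3 by rewrite divr_ge0 ?oppr_ge0// ltW.
  by rewrite vE; apply: last_seg a0 b0 (sum_gt0 _ _ _ _ _ v0 vE a0 b0).
move=> U Ul; have v0 : vpick (val U) != 0.
  by rewrite vpick0; apply: contraTneq (valP U) => ->; rewrite dimv0 andbF.
have vU := memv_pick (val U); have vl := subvP Ul _ vU.
have v0' : vpick (val U) \notin (0%VS : {vspace 'rV[R]_n.+1}) by rewrite memv0.
apply/(vectors_ofP A v0' vU).
(* A representative in the opposite half-plane is replaced by its negative. *)
have [h|/ltW h] := leP (phi i0 (vpick (val U)) : R) 0; first exact: lX.
rewrite -[vpick _]opprK -scaleN1r; apply: vectors_ofZ.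
  by rewrite oppr_eq0 oner_eq0.
by apply: lX; rewrite ?rpredN ?oppr_eq0// linearN/= oppr_le0.
Qed.
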